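(* Let $\operatorname{sa}:\mathbb{N}\to\mathbb{N}$ (with $\mathbb{N}$ the positive integers) be any function with the following property: for every $c\in\mathbb{N}$, every integer $n>\operatorname{sa}(c)$, and every poset $P$ on $2n+1$ points with $\dim(P)\ge n-c$, one has $\operatorname{se}(P)\ge n-\operatorname{sa}(c)$. Then \[ \operatorname{sa}(c)=\Omega\bigl(c^{3/2}/\log^{3/4}c\bigr)\qquad (c\to\infty). \]
   Context: The dimension $\dim(P)$ of a poset $P$ is the least positive integer $d$ for which there are linear extensions $L_1,\dots,L_d$ of $P$ such that $x\le y$ in $P$ if and only if $x\le y$ in $L_j$ for each $j\in\{1,\dots,d\}$. For $d\ge2$, the standard example $S_d$ is the height-2 poset with minimal elements $a_1,\dots,a_d$ and maximal elements $a'_1,\dots,a'_d$, in which $a_i<a'_j$ if and only if $i\ne j$. The standard example number $\operatorname{se}(P)$ is $1$ if $P$ contains no subposet isomorphic to $S_2$; otherwise it is the largest $d\ge2$ such that $P$ contains a subposet isomorphic to $S_d$. *)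

(* Defs.v *)
From HB Require Import structures.
From mathcomp Require Import all_boot all_order all_algebra.
From mathcomp Require Import all_classical all_reals all_analysis.
Set Implicit Arguments.
Unset Strict Implicit.
Unset Printing Implicit Defensive.
Import Order.TTheory GRing.Theory Num.Theory.
Import numFieldNormedType.Exports.

Local Open Scope order_scope.

(* Reflexivity of [L] follows from totality. *)
Definition linear_extension (disp : Order.disp_t) (P : finPOrderType disp)
    (L : rel P) : Prop :=
  [/\ antisymmetric L, transitive L, total L & forall x y, x <= y -> L x y].

Definition realizer (disp : Order.disp_t) (P : finPOrderType disp) (d : nat)
    (L : 'I_d -> rel P) : Prop :=
  (forall j, linear_extension (L j)) /\
  (forall x y, x <= y <-> forall j, L j x y).

Definition has_realizer (disp : Order.disp_t) (P : finPOrderType disp)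
    (d : nat) : bool :=
  (0 < d)%N && `[< exists L : 'I_d -> rel P, realizer L >].

(* For an up-closed set [U], [L] sorts lexicographically by membership in [U],
   then size of the principal down-set, then enumeration rank. *)
Lemma upset_linear_extension (disp : Order.disp_t) (P : finPOrderType disp)
    (U : pred P) :
  (forall x y, x <= y -> U x -> U y) ->
  exists2 L, linear_extension L & forall x y, L x y -> U x -> U y.
Proof.
move=> upU; pose h (x : P) := #|[pred z | z <= x]|.
pose k x := (nat_of_bool (U x), (h x, nat_of_ord (enum_rank x))).
pose L : rel P := fun x y => [|| ((k x).1 < (k y).1)%N,
  ((k x).1 == (k y).1) && ((k x).2.1 < (k y).2.1)%N |
  [&& (k x).1 == (k y).1, (k x).2.1 == (k y).2.1 & (k x).2.2 <= (k y).2.2]%N].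
have LU x y : L x y -> U x -> U y.
  by rewrite /L /=; case: (U x) => //; case: (U y).
exists L => //; split.
- move=> x y; rewrite /L; case: (ltngtP (k x).1 (k y).1) => //= _.
  case: (ltngtP (h x) (h y)) => //= _ /anti_leq /ord_inj; exact: enum_rank_inj.
- move=> y x z; rewrite /L.
  case: (ltngtP (k x).1 (k y).1) => //= [xy _|->].
    case: (ltngtP (k y).1 (k z).1) => //= [yz _|<- _]; last by rewrite xy.
    by rewrite (ltn_trans xy yz).
  case: (ltngtP (k y).1 (k z).1) => //= _.
  case: (ltngtP (h x) (h y)) => //= [xy _|->].
    case: (ltngtP (h y) (h z)) => //= [yz _|<- _]; last by rewrite xy.
    by rewrite (ltn_trans xy yz).
  by case: (ltngtP (h y) (h z)) => //= _; exact: leq_trans.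
- move=> x y; rewrite /L; case: (ltngtP (k x).1 (k y).1) => //= _.
  by case: (ltngtP (h x) (h y)) => //= _; exact: leq_total.
- move=> x y; rewrite le_eqVlt => /predU1P[->|xy]; first by rewrite /L !eqxx leqnn !orbT.
  have hxy : (h x < h y)%N.
    apply/proper_card/properP; split.
      by apply/fintype.subsetP => z; rewrite !inE => /le_trans; apply; exact: ltW.
    by exists y; rewrite !inE // lt_geF.
  have := upU _ _ (ltW xy); rewrite /L /= hxy.
  by case: (U x); case: (U y) => //= /(_ isT).
Qed.

Lemma has_realizer_ex (disp : Order.disp_t) (P : finPOrderType disp) :
  exists d, has_realizer P d.
Proof.
have upL (x : option P) : exists L : rel P, linear_extension L /\
    forall y, L (odflt y x) y -> odflt y x <= y.
  case: x => [x|] /=.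
    have [L lL LU] := @upset_linear_extension _ P (fun z => x <= z)
      (fun y z yz xy => le_trans xy yz).
    by exists L; split=> // y /LU; apply.
  have [L lL _] := @upset_linear_extension _ P xpredT (fun _ _ _ _ => isT).
  by exists L; split.
have [F FP] := boolp.choice upL.
exists #|{: option P}|; rewrite /has_realizer card_option /=; apply/asboolP.
rewrite -card_option; exists (fun j => F (enum_val j)); split=> [j|x y].
  by have [] := FP (enum_val j).
split=> [xy j|Lxy]; first by have [[_ _ _ +] _] := FP (enum_val j); apply.
by have [_ /(_ y)] := FP (Some x); apply; have := Lxy (enum_rank (Some x));
  rewrite enum_rankK.
Qed.

Definition poset_dim (disp : Order.disp_t) (P : finPOrderType disp) : nat :=
  ex_minn (has_realizer_ex P).

Variant standard_example (d : nat) : Type :=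
  | MinElt of 'I_d   (* a_i *)
  | MaxElt of 'I_d.  (* a'_i *)

Definition sum_of_standard_example (d : nat) (u : standard_example d) :
    'I_d + 'I_d :=
  match u with MinElt i => inl i | MaxElt i => inr i end.

Definition standard_example_of_sum (d : nat) (u : 'I_d + 'I_d) :
    standard_example d :=
  match u with inl i => MinElt i | inr i => MaxElt i end.

Lemma sum_of_standard_exampleK (d : nat) :
  cancel (@sum_of_standard_example d) (@standard_example_of_sum d).
Proof. by case. Qed.

HB.instance Definition _ (d : nat) :=
  Finite.copy (standard_example d) (can_type (@sum_of_standard_exampleK d)).

Definition standard_example_le (d : nat) (u v : standard_example d) : bool :=
  match u, v with
  | MinElt i, MinElt j => i == j
  | MaxElt i, MaxElt j => i == j
  | MinElt i, MaxElt j => i != j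
  | MaxElt _, MinElt _ => false
  end.

Lemma standard_example_le_refl (d : nat) : reflexive (@standard_example_le d).
Proof. by case=> i /=. Qed.

Lemma standard_example_le_anti (d : nat) :
  antisymmetric (@standard_example_le d).
Proof. by case=> i [] j //= /andP[] // /eqP->. Qed.

Lemma standard_example_le_trans (d : nat) :
  transitive (@standard_example_le d).
Proof.
by case=> j [] i [] k //=; [move/eqP-> | move/eqP-> | move=> ? /eqP<- | move/eqP->].
Qed.

Fact standard_example_display : Order.disp_t.
Proof. exact: Order.Disp tt tt. Qed.

HB.instance Definition _ (d : nat) :=
  Order.Le_isPOrder.Build standard_example_display (standard_example d)
    (@standard_example_le_refl d) (@standard_example_le_anti d)
    (@standard_example_le_trans d).

(* [P] has a subposet isomorphic to [Q]. *)
Definition contains_poset (disp : Order.disp_t) (P : finPOrderType disp)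
    (disp' : Order.disp_t) (Q : finPOrderType disp') : bool :=
  [exists f : {ffun Q -> P},
    [forall x : Q, [forall y : Q, (f x <= f y) == (x <= y)]]].

Lemma contains_standard_example_leq (disp : Order.disp_t)
    (P : finPOrderType disp) (d : nat) :
  contains_poset P (standard_example d) -> (d <= #|P|)%N.
Proof.
move=> /existsP[f /forallP fP].
have finj : injective f.
  move=> x y fxy; apply/le_anti.
  by rewrite -!(eqP (forallP (fP _) _)) fxy lexx.
rewrite -[d in (d <= _)%N]card_ord.
by apply: (leq_card (f \o @MinElt d)); apply: inj_comp => // i j [].
Qed.

(* The bound on [d] in the maximum is harmless by
   [contains_standard_example_leq]. *)
Definition se_number (disp : Order.disp_t) (P : finPOrderType disp) : nat :=
  if contains_poset P (standard_example 2) then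
    \max_(d < #|P|.+1 | (2 <= d)%N && contains_poset P (standard_example d)) d
  else 1%N.

(* Main.v *)
From HB Require Import structures.
Require Import Defs.
From mathcomp Require Import all_boot all_order all_algebra.
From mathcomp Require Import all_classical all_reals all_analysis.
From mathcomp Require Import fintype finset zify lra.
Import Order.TTheory GRing.Theory Num.Theory.
Import numFieldNormedType.Exports.
Set Implicit Arguments.
Unset Strict Implicit.
Unset Printing Implicit Defensive.

(** The proof exhibits, for every large [c], a poset on [2n+1] points with
    dimension at least [n - c] and standard example number at most [c], where
    [n] has order [c^(3/2) / log^(1/2) c].  Applied to it, the hypothesis on
    [sa] gives [sa c >= n - c >= n/2], which exceeds the required bound by a
    factor [log^(1/4) c].

    The poset has height 2 and is read off a bipartite graph [H] on [n + n]
    vertices: a lower point [x] lies below an upper point [y] unless [x] and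
    [y] are adjacent, and one isolated point fixes the parity.  Induced
    matchings of [H] are standard examples.  A linear extension [L] reverses a
    set [S] of edges (those with [y] below [x] in [L]), and a realizer is a
    family of linear extensions that reverses every edge.  Suppose that
    [d <= n - C] extensions do so, with [C = c + 1].  Removing from the [i]-th
    extension a highest lower point [a i] and a lowest upper point [b i], all
    distinct, leaves at least [C] points on either side; let [X] and [Y] be
    [C]-sets among them.  If [(x, y)] in [X * Y] is reversed by [L i], then [x]
    is adjacent to [b i] and [y] to [a i].  Moreover the edges reversed by
    [L i] form a staircase, so if [H] contains no [K_(8,8)], those inside
    [X * Y] meet the 7 highest points of [X] or the 7 lowest points of [Y].
    Thus one fourteenth of the edges between [X] and [Y] have, say, the form
    [(x, y i)] for one fixed function [y] of the index [i], and each of them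
    comes with a second edge [(x, b i)], all these edges being distinct
    ([few_reversed_classes], [fold_class]).

    A random graph of edge probability [1/m], with [m] of order
    [(C / log C)^(1/2)], does not allow this.  At least a constant proportion
    of the expected [C^2 / m] edges exist between any two [C]-sets, a number of
    order [n log n] ([few_sparse]).  The pairs of edges described above are
    determined by a function from vertices to vertices, for which there are only
    [n^n] choices, and by a set of [M = n l] pairs in [X * T], with [l] of order
    [log n]; the [2M] edges that they force outweigh the number of choices
    ([few_folded]).  Here it matters that the number of edges to be covered is
    itself of order [n log n], so that a union bound over all functions on the
    vertices is affordable. *)

(** * Counting functions with prescribed zeros *)

Lemma leq_pow2r (a b e : nat) : a <= b -> a ^ e <= b ^ e.
Proof. by case: e => // e ab; rewrite leq_exp2r. Qed.

(** Functions to ['I_m.+1] model independent random subsets of [I] in which each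
    element occurs (as a zero) with probability [1/(m+1)]; probabilities are
    ratios to [m.+1 ^ #|I|]. *)
Lemma card_vanishing (I : finType) (m : nat) (Z : {set I}) :
  #|[set w : {ffun I -> 'I_m.+1} | [forall z in Z, w z == ord0]]|
    * m.+1 ^ #|Z| = m.+1 ^ #|I|.
Proof.
rewrite -[in RHS](cardsC Z) expnD mulnC; congr (_ * _).
have := @card_pffun_on I 'I_m.+1 ord0 (mem (~: Z)) predT.
rewrite card_ord => <-.
apply: eq_card => w; rewrite !inE; apply/forall_inP/pffun_onP => [wZ|[wZ _] z Zz].
  split; last by [].
  by apply/subsetP => z; rewrite !inE; apply: contraNN => /wZ.
by apply: contraLR Zz => wz; have := subsetP wZ z; rewrite !inE; apply.
Qed.

Lemma union_bound (O K : finType) (Q : pred K) (E : K -> pred O) (d b : nat) :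
  (forall k, Q k -> #|[set w | E k w]| * d <= b) ->
  #|[set w | [exists k, Q k && E k w]]| * d <= #|Q| * b.
Proof.
move=> bE; apply: (@leq_trans (\sum_(k | Q k) #|[set w | E k w]| * d)).
  rewrite -big_distrl leq_mul2r; apply/orP; right.
  rewrite -sum1_card (eq_bigr (fun k => \sum_(w | E k w) 1)); last first.
    by move=> k _; rewrite -sum1_card; apply: eq_bigl => w; rewrite inE.
  rewrite (exchange_big_dep xpredT) //= [leqLHS]big_mkcond; apply: leq_sum => w _.
  rewrite inE; case: existsP => // -[k /andP[Qk Ekw]].
  by rewrite (bigD1 k) ?Qk.
by rewrite -sum_nat_const; apply: leq_sum.
Qed.

(** Chernoff bound for the lower tail, by averaging [2 ^ - e] where [e] is the
    number of zeros in [Z]: the average factors over the points of [I], and each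
    point of [Z] contributes [1 - 1 / (2 (m + 1))]. *)
Lemma few_zeros_bound (I : finType) (m t : nat) (Z : {set I}) :
  #|[set w : {ffun I -> 'I_m.+1} | #|[set z in Z | w z == ord0]| < t]|
    * (2 * m.+1) ^ #|Z| <= 2 ^ t * (2 * m).+1 ^ #|Z| * m.+1 ^ #|I|.
Proof.
pose weight z (v : 'I_m.+1) := if (z \in Z) && (v != ord0) then 2 else 1.
have weightE (w : {ffun I -> 'I_m.+1}) :
    2 ^ #|Z| = (\prod_z weight z (w z)) * 2 ^ #|[set z in Z | w z == ord0]|.
  rewrite -big_mkcond /= prod_nat_const -expnD addnC; congr (2 ^ _).
  rewrite -(cardsID [set z | w z == ord0] Z); congr (_ + _).
    by apply: eq_card => z; rewrite !inE.
  by apply: eq_card => z; rewrite !inE andbC.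
have sum_weight : \sum_(w : {ffun I -> 'I_m.+1}) \prod_z weight z (w z)
    = (2 * m).+1 ^ #|Z| * m.+1 ^ #|~: Z|.
  rewrite -(bigA_distr_bigA weight) /= (bigID (mem Z)) /= -!prod_nat_const.
  congr (_ * _); last first.
    apply: eq_big => z; first by rewrite !inE.
    move/negbTE=> zZ; rewrite /weight zZ /= sum1_card card_ord //.
  apply: eq_bigr => z zZ; rewrite /weight zZ /=.
  rewrite big_ord_recl /= (eq_bigr (fun=> 2)) // sum_nat_const card_ord; lia.
rewrite expnMn mulnA -[in leqRHS](cardsC Z) expnD.
rewrite [leqRHS](_ : _ = 2 ^ t * ((2 * m).+1 ^ #|Z| * m.+1 ^ #|~: Z|) * m.+1 ^ #|Z|);
  last by lia.
rewrite leq_mul2r; apply/orP; right; rewrite -sum_weight big_distrr /=.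
rewrite -sum_nat_const [leqLHS]big_mkcond; apply: leq_sum => w _; rewrite inE.
case: ltnP => // /ltnW lt_t; rewrite (weightE w) mulnC leq_mul2r.
by rewrite leq_exp2l // lt_t orbT.
Qed.

Lemma card_subsets (T : finType) : #|{: {set T}}| = 2 ^ #|T|.
Proof. by rewrite -(cardsT T) -card_powerset powersetT cardsT. Qed.

Lemma ffact_le_exp (n k : nat) : n ^_ k <= n ^ k.
Proof. by elim: k => // k IHk; rewrite ffactnSr expnSr leq_mul ?leq_subr. Qed.

(** A form of ['C(n, k) <= (e n / k) ^ k] with 4 in place of [e]: the estimate
    [k ^ k <= 4 ^ k * k`!] follows from ['C(2k, k) <= 4 ^ k]. *)
Lemma exp_le_bin_mul (n k : nat) : 'C(n, k) * k ^ k <= (4 * n) ^ k.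
Proof.
have ffact_ge j : k ^ j <= (2 * k) ^_ j \/ k < j.
  elim: j => [|j [IHj|]]; [by left | | by right; apply: ltnW].
  have [kj|kj] := ltnP j k; last by right.
  by left; rewrite expnSr ffactnSr leq_mul //; lia.
have {ffact_ge} kk : k ^ k <= 4 ^ k * k`!.
  have [|] := ffact_ge k; last by rewrite ltnn.
  move=> /leq_trans; apply; rewrite -bin_ffact leq_mul2r; apply/orP; right.
  have := @card_draws 'I_(2 * k) k; rewrite card_ord => <-.
  apply: leq_trans (max_card _) _.
  by rewrite card_subsets card_ord expnM.
apply: (@leq_trans ('C(n, k) * (4 ^ k * k`!))); first by rewrite leq_mul2l kk orbT.
by rewrite mulnCA bin_ffact expnMn leq_mul2l ffact_le_exp orbT.
Qed.

Lemma bernoulli_nat (q j : nat) : q ^ j * (q + j) <= q.+1 ^ j * q.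
Proof.
elim: j => [|j IHj]; first by rewrite addn0.
rewrite [q.+1 ^ _]expnS -mulnA.
apply: leq_trans (leq_mul (leqnn q.+1) IHj).
by rewrite expnS; set p := q ^ j; nia.
Qed.

(** The integer form of [(1 - 1 / (2 (m + 1))) ^ e <= 2 ^ - k]. *)
Lemma halving_pow (m k e : nat) :
  2 * m.+1 * k <= e -> 2 ^ k * (2 * m).+1 ^ e <= (2 * m.+1) ^ e.
Proof.
pose d := 2 * m.+1 * k; rewrite -/d => ke.
rewrite -(subnK ke) 2!(expnD _ (e - d) d) mulnCA; apply: leq_mul.
  by apply: leq_pow2r; lia.
rewrite /d 2!(expnM _ (2 * m.+1)) -expnMn; apply: leq_pow2r.
have := bernoulli_nat (2 * m).+1 (2 * m.+1).
have -> : (2 * m).+2 = 2 * m.+1 by lia.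
set a := _ ^ (2 * m.+1); set b := _ ^ (2 * m.+1); nia.
Qed.

(** * Random bipartite graphs *)

Lemma card_vanishing_inj (I J : finType) (f : J -> I) (m : nat) (Z : {set J}) :
  injective f ->
  #|[set w : {ffun I -> 'I_m.+1} | [forall z in Z, w (f z) == ord0]]|
    * m.+1 ^ #|Z| = m.+1 ^ #|I|.
Proof.
move=> injf; rewrite -(card_vanishing m (f @: Z)) card_imset //; congr (_ * _).
apply: eq_card => w; rewrite !inE; apply/forall_inP/forall_inP => wZ z.
  by case/imsetP => x Zx ->; apply: wZ.
by move=> Zz; apply: wZ; apply: imset_f.
Qed.

Section Graphs.

Variable T : finType.
Implicit Types (H : rel T) (X Y : {set T}) (W : {set T * T}) (g : {ffun T -> T}).

Definition edges_between H X Y := [set z in setX X Y | H z.1 z.2].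

Definition edge_dense (C t : nat) H := forall X Y,
  #|X| = C -> #|Y| = C -> t <= #|edges_between H X Y|.

(** [W] is read as a set of edges [(x, b)], and each of them is paired with the
    edge [(x, g b)]. *)
Definition with_fold g W := W :|: [set (z.1, g z.2) | z in W].

(** The condition that [with_fold g W] has [2 * M] elements says that the edges
    [(x, b)] and their partners [(x, g b)] are pairwise distinct, so that they
    are independent in a random graph. *)
Definition fold_free (C M : nat) H := forall X g W,
  #|X| = C -> W \subset setX X setT -> #|W| = M -> #|with_fold g W| = 2 * M ->
  ~~ [forall z in with_fold g W, H z.1 z.2].

Definition biclique_free (k : nat) H := forall X Y,
  #|X| = k -> #|Y| = k -> ~~ [forall z in setX X Y, H z.1 z.2].

Variable m : nat.
Let graph := {ffun T * T -> 'I_m.+1}.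
Implicit Type w : graph.

Definition zero_graph w : rel T := fun x y => w (x, y) == ord0.

(** The deviation bound [few_zeros_bound] beats the [4 ^ #|T|] choices of a pair
    of vertex sets. *)
Lemma few_sparse (C t : nat) : 2 * m.+1 * (2 * #|T| + t + 3) <= C ^ 2 ->
  #|[set w : graph | [exists k : {set T} * {set T},
      ((#|k.1| == C) && (#|k.2| == C)) &&
      (#|edges_between (zero_graph w) k.1 k.2| < t)]]| * 8 <= #|graph|.
Proof.
move=> hC; rewrite card_ffun card_ord.
have hXY (k : {set T} * {set T}) : (#|k.1| == C) && (#|k.2| == C) ->
    #|[set w : graph | #|edges_between (zero_graph w) k.1 k.2| < t]|
      * 2 ^ (2 * #|T| + 3) <= m.+1 ^ #|{: T * T}|.
  case/andP => /eqP kX /eqP kY.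
  have := few_zeros_bound m t (setX k.1 k.2).
  rewrite cardsX kX kY mulnn.
  have -> : [set w : graph | #|edges_between (zero_graph w) k.1 k.2| < t] =
      [set w : graph | #|[set z in setX k.1 k.2 | w z == ord0]| < t].
    apply/setP => w; rewrite !inE; congr (_ < _).
    by apply: eq_card => -[x y]; rewrite !inE.
  have := halving_pow hC.
  rewrite (_ : 2 * #|T| + t + 3 = t + (2 * #|T| + 3)); last by lia.
  rewrite expnD.
  set b := #|_|; set u := (2 * m).+1 ^ _; set v := (2 * m.+1) ^ _.
  set O := m.+1 ^ _; set s := 2 ^ t; set r := 2 ^ _ => h1 h2.
  have u0 : 0 < s * u by rewrite muln_gt0 !expn_gt0.
  rewrite -(leq_pmul2r u0).
  apply: (@leq_trans (b * v)); last by lia.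
  by rewrite -mulnA leq_mul2l; apply/orP; right; lia.
have := union_bound hXY; rewrite expnD mulnA.
have card_le : #|[pred k : {set T} * {set T} | (#|k.1| == C) && (#|k.2| == C)]|
    <= 2 ^ (2 * #|T|).
  apply: leq_trans (max_card _) _.
  by rewrite card_prod card_subsets -expnD addnn mul2n.
move=> /leq_trans/(_ (leq_mul card_le (leqnn _))).
by rewrite [leqLHS]mulnAC mulnC leq_pmul2l ?expn_gt0.
Qed.

(** There are [2 ^ n * n ^ n] pairs [(X, g)] and ['C(C n, M)] sets [W], and each
    configuration has probability [(m + 1) ^ - (2M)].  Since [W] is an unordered set,
    the binomial coefficient contributes [(4 C n / M) ^ M]; this division by
    [M ^ M] is what makes the estimate work.  The injection [f] permits the same
    bound for the graph and for its transpose. *)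
Lemma few_folded (f : T * T -> T * T) (C M : nat) : injective f ->
  16 * C * #|T| <= M * m.+1 ^ 2 -> 8 * (2 * #|T|) ^ #|T| <= 4 ^ M ->
  #|[set w : graph | [exists k : {set T} * {ffun T -> T}, (#|k.1| == C) &&
      [exists W : {set T * T}, [&& W \subset setX k.1 setT, #|W| == M &
          #|with_fold k.2 W| == 2 * M] &&
        [forall z in with_fold k.2 W, w (f z) == ord0]]]]| * 8 <= #|graph|.
Proof.
move=> injf hC hM; rewrite card_ffun card_ord; set n := #|T| in hC hM *.
set bad := #|_|; pose O := m.+1 ^ #|{: T * T}|; rewrite -/O.
have inner (k : {set T} * {ffun T -> T}) : #|k.1| == C ->
    #|[set w : graph |
      [exists W : {set T * T}, [&& W \subset setX k.1 setT, #|W| == M &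
          #|with_fold k.2 W| == 2 * M] &&
        [forall z in with_fold k.2 W, w (f z) == ord0]]]| * m.+1 ^ (2 * M)
      <= 'C(C * n, M) * O.
  move=> /eqP kC.
  apply: (@leq_trans _ _ _ (@union_bound _ _ _ _ _ O _) _) => [W|].
    by case/and3P => _ _ /eqP <-; rewrite (@card_vanishing_inj _ _ f).
  rewrite leq_mul2r; apply/orP; right.
  rewrite -kC -[n](cardsT T) -cardsX -cards_draws -[leqRHS]cardsE.
  apply: subset_leq_card; apply/subsetP => W.
  by rewrite !inE => /and3P[-> -> _].
have := union_bound inner; rewrite -/bad.
have card_le : #|[pred k : {set T} * {ffun T -> T} | #|k.1| == C]|
    <= (2 * n) ^ n.
  apply: leq_trans (max_card _) _.
  by rewrite card_prod card_subsets card_ffun expnMn.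
move=> /leq_trans/(_ (leq_mul card_le (leqnn _))) hbad.
have binM := exp_le_bin_mul (C * n) M.
have hpow : (4 * (C * n)) ^ M * 4 ^ M <= M ^ M * m.+1 ^ (2 * M).
  by rewrite expnM -!expnMn; apply: leq_pow2r; lia.
have d0 : 0 < M ^ M * m.+1 ^ (2 * M) * 4 ^ M.
  by rewrite !muln_gt0 !expn_gt0; case: (M).
rewrite -(leq_pmul2r d0).
move: hbad binM hpow hM; move: ('C(_, _)) (m.+1 ^ _) (M ^ M) (4 ^ M) ((4 * _) ^ M).
move=> B p q r s; move: ((2 * n) ^ n) => a h1 h2 h3 h4.
have := leq_mul h1 (leqnn (8 * q * r)); have := leq_mul h2 (leqnn (8 * a * O * r)).
have := leq_mul h3 (leqnn (8 * a * O)); have := leq_mul h4 (leqnn (O * q * p)).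
by lia.
Qed.

Lemma few_bicliques (k : nat) : 8 * #|T| ^ (2 * k) <= m.+1 ^ (k * k) ->
  #|[set w : graph | [exists p : {set T} * {set T},
      ((#|p.1| == k) && (#|p.2| == k)) &&
      [forall z in setX p.1 p.2, w z == ord0]]]| * 8 <= #|graph|.
Proof.
move=> hk; rewrite card_ffun card_ord.
set bad := #|_|; pose O := m.+1 ^ #|{: T * T}|; rewrite -/O.
have hb : bad * m.+1 ^ (k * k) <= #|T| ^ (2 * k) * O.
  apply: (@leq_trans _ _ _ (@union_bound _ _ _ _ _ O _) _).
    move=> p /andP[/eqP p1 /eqP p2].
    by rewrite -{1}p1 -p2 -cardsX card_vanishing.
  rewrite leq_mul2r; apply/orP; right.
  have -> : #|[pred p : {set T} * {set T} | (#|p.1| == k) && (#|p.2| == k)]|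
      = #|setX [set A : {set T} | #|A| == k] [set A : {set T} | #|A| == k]|.
    by apply: eq_card => -[X Y]; rewrite !inE.
  rewrite cardsX card_draws mul2n -addnn expnD.
  have binT : 'C(#|T|, k) <= #|T| ^ k.
    by apply: leq_trans (ffact_le_exp _ _); rewrite -bin_ffact leq_pmulr ?fact_gt0.
  exact: leq_mul.
have d0 : 0 < m.+1 ^ (k * k) by rewrite expn_gt0.
rewrite -(leq_pmul2r d0).
by have := leq_mul hk (leqnn O); lia.
Qed.

(** Each of the four bad events has probability at most [1/8]. *)
Lemma random_graph (C M t k : nat) :
  2 * m.+1 * (2 * #|T| + t + 3) <= C ^ 2 ->
  16 * C * #|T| <= M * m.+1 ^ 2 -> 8 * (2 * #|T|) ^ #|T| <= 4 ^ M ->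
  8 * #|T| ^ (2 * k) <= m.+1 ^ (k * k) ->
  exists H : rel T, [/\ edge_dense C t H, fold_free C M H,
    fold_free C M (fun x y => H y x) & biclique_free k H].
Proof.
move=> h1 h2 h3 h4; have := few_sparse h1; have := few_bicliques h4.
have swap_inj : injective (fun z : T * T => (z.2, z.1)) by move=> [a b] [c d] [-> ->].
have := few_folded swap_inj h2 h3.
have := few_folded (@inj_id _) h2 h3.
set b1 := [set w | _]; set b2 := [set w | _]; set b3 := [set w | _].
set b4 := [set w | _] => c1 c2 c3 c4.
have [w] : exists w : graph, w \notin b1 :|: b2 :|: (b3 :|: b4).
  apply/existsP; rewrite -negb_forall; apply/negP => /forallP all_bad.
  have full : #|b1 :|: b2 :|: (b3 :|: b4)| = #|graph|.
    by rewrite -[RHS]cardsT; apply: eq_card => w; rewrite all_bad inE.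
  have graph0 : 0 < #|graph| by rewrite card_ffun card_ord expn_gt0.
  have setU_le (A B : {set graph}) : #|A :|: B| <= #|A| + #|B|.
    by rewrite leq_card_setU.
  have arith (N x1 x2 x3 x4 y1 y2 : nat) : 0 < N -> x1 * 8 <= N -> x2 * 8 <= N ->
    x3 * 8 <= N -> x4 * 8 <= N -> y1 <= x1 + x2 -> y2 <= x3 + x4 ->
    N <= y1 + y2 -> False by lia.
  apply: (arith _ _ _ _ _ _ _ graph0 c1 c2 c3 c4 (setU_le _ _) (setU_le _ _)).
  by rewrite -full; apply: setU_le.
rewrite !inE !negb_or -!andbA => /and4P[n1 n2 n3 n4].
exists (zero_graph w); split.
- move=> X Y kX kY; rewrite leqNgt; apply: contra n4 => lt_t.
  by apply/existsP; exists (X, Y); rewrite /= kX kY !eqxx.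
- move=> X g W kX sW kW kZ; apply: contra n1 => wZ.
  apply/existsP; exists (X, g); rewrite /= kX eqxx /=.
  apply/existsP; exists W; rewrite sW kW kZ !eqxx /=.
  by apply/forall_inP => -[x y] /(forall_inP wZ).
- move=> X g W kX sW kW kZ; apply: contra n2 => wZ.
  apply/existsP; exists (X, g); rewrite /= kX eqxx /=.
  apply/existsP; exists W; rewrite sW kW kZ !eqxx /=.
  by apply/forall_inP => -[x y] /(forall_inP wZ).
- move=> X Y kX kY; apply: contra n3 => wZ.
  apply/existsP; exists (X, Y); rewrite /= kX kY !eqxx /=.
  by apply/forall_inP => -[x y] /(forall_inP wZ).
Qed.

End Graphs.

(** * Extremal points, folded edge sets, and the poset of a bipartite graph *)

Lemma exists_subset_card (T : finType) (A : {set T}) (k : nat) :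
  k <= #|A| -> exists2 B : {set T}, B \subset A & #|B| = k.
Proof.
move=> kA; have : 0 < 'C(#|A|, k) by rewrite bin_gt0.
rewrite -cards_draws => /card_gt0P[B]; rewrite inE => /andP[BA /eqP Bk].
by exists B.
Qed.

(** Minima are removed one after the other, so that they are distinct even when
    several of the orders have the same minimum on [X]; an element that is never
    removed stays above each [f i] in the [i]-th order. *)
Lemma greedy_extremes (T : finType) (d : nat) (R : 'I_d -> rel T) (X : {set T}) :
  (forall i, total (R i)) -> (forall i, transitive (R i)) -> d <= #|X| ->
  exists f : 'I_d -> T, [/\ injective f, forall i, f i \in X &
    forall i x, x \in X -> x \notin codom f -> R i (f i) x].
Proof.
elim: d R X => [|d IHd] R X totR trR dX.
  have f : 'I_0 -> T by case.
  by exists f; split; case.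
have [x0 X0] : exists x, x \in X by apply/card_gt0P; apply: leq_trans dX.
have [f0 Xf0 minf0] : exists2 f0, f0 \in X & forall x, x \in X -> R ord0 f0 x.
  have refR : reflexive (R ord0) by move=> x; have := totR ord0 x x; rewrite orbb.
  have := @extremumP T T (R ord0) x0 (mem X) id refR (trR ord0) (totR ord0) X0.
  by case=> x Xx minx; exists x.
have [||| f [injf Xf minf]] := IHd (fun i => R (lift ord0 i)) (X :\ f0).
- by move=> i; apply: totR.
- by move=> i; apply: trR.
- by rewrite (cardsD1 f0) Xf0 in dX.
exists (fun i => if unlift ord0 i is Some j then f j else f0); split.
- move=> i j; case: unliftP => [i'|] ->; case: unliftP => [j'|] -> //.
  + by move/injf->.
  + by move=> e; have := Xf i'; rewrite e !inE eqxx.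
  + by move=> e; have := Xf j'; rewrite -e !inE eqxx.
- by move=> i; case: unliftP => [j|] _ //; have := Xf j; rewrite inE => /andP[].
move=> i x Xx xf; case: unliftP => [j|] ->; last exact: minf0.
apply: minf.
  rewrite !inE Xx andbT; apply: contra xf => /eqP ->.
  by apply/codomP; exists ord0; rewrite unlift_none.
apply: contra xf => /codomP[j' ->].
by apply/codomP; exists (lift ord0 j'); rewrite liftK.
Qed.

(** Every edge [(x, c i)] of [E] is sent to the edge [(x, b i)]; as [b] is
    injective, [i] is recovered from [b i], and [g] with [g (b i) = c i] folds
    the images back onto [E].  The points [b i] lie outside [Y], so the two sets
    of edges are disjoint. *)
Lemma fold_class (T : finType) (H : rel T) (C M d : nat) (X Y : {set T})
    (b c : 'I_d -> T) (E : {set T * T}) :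
  fold_free C M H -> #|X| = C -> injective b -> (forall i, b i \notin Y) ->
  E \subset setX X Y ->
  (forall z, z \in E -> H z.1 z.2 /\ exists i, H z.1 (b i) /\ z.2 = c i) ->
  #|E| < M.
Proof.
move=> foldH kX injb bY sE hE; rewrite ltnNge; apply/negP => ME.
have [F sFE kF] := exists_subset_card ME.
pose h z := if [pick i | H z.1 (b i) && (z.2 == c i)] is Some i
            then (z.1, b i) else z.
pose g := [ffun y => if [pick i | b i == y] is Some i then c i else y].
have gb i : g (b i) = c i.
  rewrite ffunE; case: pickP => [j /eqP/injb -> //|/(_ i)].
  by rewrite eqxx.
have hP z : z \in F -> exists i, [/\ h z = (z.1, b i), H z.1 (b i) & z.2 = c i].
  move=> /(subsetP sFE)/hE[_ [i [Hi ci]]]; rewrite /h.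
  case: pickP => [j /andP[Hj /eqP cj]|/(_ i)]; first by exists j.
  by rewrite Hi ci eqxx.
have foldh z : z \in F -> ((h z).1, g (h z).2) = z.
  by case/hP => i [-> _ /= ci]; rewrite gb -ci; case: (z).
have XYF z : z \in F -> (z.1 \in X) && (z.2 \in Y).
  by move=> /(subsetP sFE)/(subsetP sE); rewrite inE.
have kW : #|h @: F| = M.
  rewrite card_in_imset // => z z' Fz Fz' e.
  by rewrite -(foldh z) // e foldh.
have foldE : [set (z.1, g z.2) | z in h @: F] = F.
  apply/setP => z; apply/imsetP/idP => [[_ /imsetP[z' Fz' ->] ->]|Fz].
    by rewrite foldh.
  by exists (h z); rewrite ?imset_f ?foldh.
have kZ : #|with_fold g (h @: F)| = 2 * M.
  rewrite /with_fold foldE cardsU kW kF (_ : _ :&: _ = set0) ?cards0; first lia.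
  apply/setP => z; rewrite !inE; apply/negbTE/negP => /andP[/imsetP[z' Fz' ->]].
  have [i [-> _ _]] := hP _ Fz'.
  by move/XYF => /= /andP[_]; rewrite (negbTE (bY i)).
have sW : h @: F \subset setX X setT.
  apply/subsetP => _ /imsetP[z Fz ->]; have [i [-> _ _]] := hP _ Fz.
  by rewrite !inE; have /andP[->] := XYF _ Fz.
have /negP := foldH X g _ kX sW kW kZ; apply; apply/forall_inP => z.
rewrite /with_fold foldE inE => /orP[/imsetP[z' Fz' ->]|Fz].
  by have [i [-> Hi _]] := hP _ Fz'.
by have [] := hE _ (subsetP sFE _ Fz).
Qed.

(** The points of the height-two poset whose comparabilities form the bipartite
    complement of [H]; [None] is an isolated point.  The argument [H] only
    serves to select the order attached to the type. *)
Definition cobip (T : finType) (H : rel T) : predArgType := option (T + T).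

HB.instance Definition _ (T : finType) (H : rel T) :=
  Finite.copy (cobip H) (option (T + T)).

Section Cobip.

Variables (T : finType) (H : rel T).

Definition lower (x : T) : cobip H := Some (inl x).
Definition upper (y : T) : cobip H := Some (inr y).

Definition cobip_le (u v : cobip H) : bool := (u == v) ||
  (if u is Some (inl x) then if v is Some (inr y) then ~~ H x y else false else false).

Lemma cobip_le_refl : reflexive cobip_le.
Proof. by move=> u; rewrite /cobip_le eqxx. Qed.

Lemma cobip_le_anti : antisymmetric cobip_le.
Proof.
move=> [[x|x]|] [[y|y]|] //=; rewrite /cobip_le ?orbF;
  by do ?case/andP => /eqP.
Qed.

Lemma cobip_le_trans : transitive cobip_le.
Proof.
move=> v u w /orP[/eqP->//|uv] /orP[/eqP <-|vw]; first by rewrite /cobip_le uv orbT.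
by case: u v w uv vw => [[x|x]|] [[y|y]|] // [[z|z]|].
Qed.

End Cobip.

Fact cobip_display : Order.disp_t.
Proof. exact: Order.Disp tt tt. Qed.

HB.instance Definition _ (T : finType) (H : rel T) :=
  Order.Le_isPOrder.Build cobip_display (cobip H)
    (@cobip_le_refl T H) (@cobip_le_anti T H) (@cobip_le_trans T H).

Lemma card_cobip (T : finType) (H : rel T) : #|cobip H| = 2 * #|T| + 1.
Proof. by rewrite card_option card_sum addn1 addnn mul2n. Qed.

Lemma lower_le_upper (T : finType) (H : rel T) (x y : T) :
  (lower H x <= upper H y)%O = ~~ H x y.
Proof. by []. Qed.

(** * Dimension and standard examples *)

Section Dimension.

Variables (T : finType) (H : rel T) (d : nat) (L : 'I_d -> rel (cobip H)).
Hypothesis realL : realizer L.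

Let S (i : 'I_d) (x y : T) : bool := L i (upper H y) (lower H x).

Lemma reversed_sub (i : 'I_d) (x y : T) : S i x y -> H x y.
Proof.
have [antiL _ _ leL] := realL.1 i.
move=> Sxy; apply/negPn/negP; rewrite -lower_le_upper => /leL Lxy.
by have := antiL (lower H x) (upper H y); rewrite Lxy => /(_ Sxy).
Qed.

Lemma reversed_cover (x y : T) : H x y -> exists i, S i x y.
Proof.
move=> Hxy; apply/existsP; apply: contraT => /existsPn noS.
suff: (lower H x <= upper H y)%O by rewrite lower_le_upper Hxy.
apply/(realL.2 _ _) => i; have [_ _ totL _] := realL.1 i.
have := totL (lower H x) (upper H y).
by have := noS i; rewrite /S => /negbTE ->; rewrite orbF.
Qed.

(** The edges in [X * Y] reversed by one extension form a staircase (Ferrers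
    diagram).  A cell outside the [r] top rows and the [r] left columns would
    span a [K_(r+1, r+1)] together with them, so [r] rows and [r] columns cover
    the staircase.  Collecting the [j]-th rows (columns) of all extensions gives
    [2 r] classes of edges, each bounded by [fold_class]. *)
Lemma few_reversed_classes (C M r : nat) (X Y : {set T}) (a b : 'I_d -> T) :
  injective a -> injective b ->
  (forall i, a i \notin X) -> (forall i, b i \notin Y) ->
  (forall i x, x \in X -> L i (lower H x) (lower H (a i))) ->
  (forall i y, y \in Y -> L i (upper H (b i)) (upper H y)) ->
  fold_free C M H -> fold_free C M (fun x y => H y x) -> biclique_free r.+1 H ->
  #|X| = C -> #|Y| = C -> r <= C -> 0 < r -> 0 < M ->
  #|edges_between H X Y| < 2 * r * M.
Proof.
move=> inja injb aX bY topa botb foldH foldHT bicl kX kY rC r0 M0.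
have trL i : transitive (L i) by have [] := realL.1 i.
have totL i : total (L i) by have [] := realL.1 i.
have /boolp.choice[xs xsP] i : exists xs : 'I_r -> T,
    [/\ injective xs, forall j, xs j \in X & forall j x, x \in X ->
      x \notin codom xs -> L i (lower H x) (lower H (xs j))].
  apply: (@greedy_extremes T r (fun _ x x' => L i (lower H x') (lower H x)));
    last by rewrite kX.
    by move=> _ x y; apply: totL.
  by move=> _ y x z Lyx Lzy; apply: trL Lzy Lyx.
have /boolp.choice[ys ysP] i : exists ys : 'I_r -> T,
    [/\ injective ys, forall j, ys j \in Y & forall j y, y \in Y ->
      y \notin codom ys -> L i (upper H (ys j)) (upper H y)].
  apply: (@greedy_extremes T r (fun _ y y' => L i (upper H y) (upper H y')));
    last by rewrite kY.
    by move=> _ x y; apply: totL.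
  by move=> _ y x z; apply: trL.
(* Pairs reversed with [x] below the top rows and [y] above the bottom columns
   force all the pairs between [x], these rows, [y] and these columns. *)
have corner i x y : x \in X -> y \in Y -> S i x y ->
    (x \in codom (xs i)) || (y \in codom (ys i)).
  have [injx xsX topx] := xsP i; have [injy ysY boty] := ysP i.
  move=> Xx Yy Sxy; apply/negPn/negP; rewrite negb_or => /andP[xN yN].
  have := bicl (x |: [set z in codom (xs i)]) (y |: [set z in codom (ys i)]).
  rewrite !cardsU1 !inE xN yN !cardsE !card_codom // card_ord.
  move=> /(_ erefl erefl)/negP; apply; apply/forall_inP => -[x' y'].
  rewrite !inE /= => /andP[hx hy]; apply: (@reversed_sub i).
  have Lx : L i (lower H x) (lower H x').
    case/predU1P: hx => [->|/codomP[j ->]]; last exact: topx.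
    by have := totL i (lower H x) (lower H x); rewrite orbb.
  have Ly : L i (upper H y') (upper H y).
    case/predU1P: hy => [->|/codomP[j ->]]; last exact: boty.
    by have := totL i (upper H y) (upper H y); rewrite orbb.
  exact: trL (trL _ _ _ _ Ly Sxy) Lx.
pose row j := [set z in edges_between H X Y |
  [exists i, S i z.1 z.2 && (z.1 == xs i j)]].
pose col j := [set z in edges_between H X Y |
  [exists i, S i z.1 z.2 && (z.2 == ys i j)]].
have col_lt j : #|col j| < M.
  apply: (@fold_class _ H C M d X Y b (ys^~ j)) => //.
    by apply/subsetP => z; rewrite !inE => /andP[/andP[]].
  move=> z; rewrite !inE => /andP[/andP[/andP[Xz Yz] Hz] /existsP[i /andP[Sz /eqP zy]]].
  split=> //; exists i; split=> //; apply: (@reversed_sub i).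
  exact: trL (botb _ _ Yz) Sz.
have row_lt j : #|row j| < M.
  have injs : injective (fun z : T * T => (z.2, z.1)) by move=> [? ?] [? ?] [-> ->].
  rewrite -(card_imset _ injs).
  apply: (@fold_class _ (fun x y => H y x) C M d Y X a (xs^~ j)) => //.
    apply/subsetP => _ /imsetP[z + ->]; rewrite !inE /=.
    by case/andP => /andP[/andP[-> ->]].
  move=> _ /imsetP[z + ->]; rewrite !inE /=.
  move=> /andP[/andP[/andP[Xz Yz] Hz] /existsP[i /andP[Sz /eqP zx]]].
  split=> //; exists i; split=> //; apply: (@reversed_sub i).
  exact: trL Sz (topa _ _ Xz).
have cover : edges_between H X Y \subset \bigcup_(j < r) (row j :|: col j).
  apply/subsetP => z Ez; have := Ez; rewrite !inE => /andP[/andP[Xz Yz] Hz].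
  have [i Sz] := reversed_cover Hz.
  have := corner i _ _ Xz Yz Sz => /orP[/codomP[j zj]|/codomP[j zj]].
    apply/bigcupP; exists j => //; apply/setUP; left.
    by rewrite inE Ez /=; apply/existsP; exists i; rewrite Sz zj eqxx.
  apply/bigcupP; exists j => //; apply/setUP; right.
  by rewrite inE Ez /=; apply/existsP; exists i; rewrite Sz zj eqxx.
apply: leq_ltn_trans (subset_leq_card cover) _.
apply: (@leq_ltn_trans (\sum_(j < r) 2 * M.-1)); last first.
  by rewrite sum_nat_const card_ord; nia.
have bigcup_le (F : 'I_r -> {set T * T}) :
    #|\bigcup_(j < r) F j| <= \sum_(j < r) #|F j|.
  elim/big_rec2: _ => [|j n A _ IH]; first by rewrite cards0.
  by apply: leq_trans (leq_add (leqnn _) IH); rewrite leq_card_setU.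
apply: leq_trans (bigcup_le _) _; apply: leq_sum => j _.
have : #|row j :|: col j| <= #|row j| + #|col j| by rewrite leq_card_setU.
move/leq_trans; apply; rewrite mul2n -addnn.
by apply: leq_add; rewrite -ltnS prednK.
Qed.

(** The points [a i] and [b i] removed greedily take up at most [d] points on
    each side, so [d + C <= #|T|] leaves room for [X] and [Y]. *)
Lemma realizer_size (C M r : nat) :
  edge_dense C (2 * r * M) H ->
  fold_free C M H -> fold_free C M (fun x y => H y x) -> biclique_free r.+1 H ->
  r <= C -> 0 < r -> 0 < M -> #|T| < d + C.
Proof.
move=> denseH foldH foldHT bicl rC r0 M0; rewrite ltnNge; apply/negP => dC.
have trL i : transitive (L i) by have [] := realL.1 i.
have totL i : total (L i) by have [] := realL.1 i.
have dT : d <= #|[set: T]| by rewrite cardsT; lia.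
have rest (f : 'I_d -> T) : injective f ->
    exists2 X : {set T}, #|X| = C & forall x, x \in X -> x \notin codom f.
  move=> injf; have : C <= #|~: [set x in codom f]|.
    by have := cardsC [set x in codom f]; rewrite cardsE card_codom // card_ord; lia.
  case/exists_subset_card => X sX kX; exists X => // x /(subsetP sX).
  by rewrite !inE.
have [||a [inja _ topa]] :=
  @greedy_extremes T d (fun i x y => L i (lower H y) (lower H x)) setT _ _ dT.
- by move=> i x y; apply: totL.
- by move=> i y x z Lyx Lzy; apply: trL Lzy Lyx.
have [||b [injb _ botb]] :=
  @greedy_extremes T d (fun i x y => L i (upper H x) (upper H y)) setT _ _ dT.
- by move=> i x y; apply: totL.
- by move=> i y x z; apply: trL.
have [X kX Xa] := rest a inja; have [Y kY Yb] := rest b injb.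
suff: #|edges_between H X Y| < 2 * r * M by rewrite ltnNge denseH.
apply: (@few_reversed_classes C M r X Y a b) => //.
- by move=> i; apply: contraT => /negPn/Xa; rewrite codom_f.
- by move=> i; apply: contraT => /negPn/Yb; rewrite codom_f.
- by move=> i x /Xa xa; apply: topa.
- by move=> i y /Yb yb; apply: botb.
Qed.

End Dimension.

Lemma cobip_dim (T : finType) (H : rel T) (C M r : nat) :
  edge_dense C (2 * r * M) H ->
  fold_free C M H -> fold_free C M (fun x y => H y x) -> biclique_free r.+1 H ->
  r <= C -> 0 < r -> 0 < M -> #|T| < poset_dim (cobip H) + C.
Proof.
move=> h1 h2 h3 h4 rC r0 M0; rewrite /poset_dim; case: ex_minnP => d.
by case/andP => _ /asboolP[L realL] _; exact: (realizer_size realL h1 h2 h3 h4).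
Qed.

(** A standard example of size at least [C] is an induced matching of [H], and
    [C] of its edges give two [C]-sets with only [C] edges between them.  Two
    distinct comparable points are a lower and an upper point, which locates
    the embedded points as soon as each index has a different one. *)
Lemma cobip_se (T : finType) (H : rel T) (C t : nat) :
  edge_dense C t H -> C < t -> 1 < C -> se_number (cobip H) < C.
Proof.
move=> denseH Ct C1; rewrite /se_number; case: ifP => // _.
rewrite -[C]prednK; last by lia.
rewrite ltnS; apply/bigmax_leqP => d /andP[d2 /existsP[f /forallP fP]].
rewrite leqNgt; apply/negP => Cd; have {}Cd : C <= d by lia.
have {}fP u v : (f u <= f v)%O = (u <= v)%O by apply/eqP/(forallP (fP u) v).
have other (i : 'I_d) : exists j : 'I_d, i != j.
  have [d0 d1] : 0 < d /\ 1 < d by lia.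
  have [e|] := eqVneq i (Ordinal d0); last by exists (Ordinal d0).
  by exists (Ordinal d1); rewrite e.
have strict (u v : cobip H) : (u <= v)%O -> u != v ->
    exists x y, u = lower H x /\ v = upper H y.
  move=> /orP[/eqP-> /eqP//|]; case: u => [[x|x]|] //; case: v => [[y|y]|] // _ _.
  by exists x, y.
have injf : injective f.
  by move=> u v fuv; apply/le_anti; rewrite -!fP fuv lexx.
have pair (i j : 'I_d) : i != j -> exists x y,
    f (MinElt i) = lower H x /\ f (MaxElt j) = upper H y.
  move=> ij; apply: strict; first by rewrite fP.
  by apply/eqP => /injf.
have /boolp.choice[a aP] (i : 'I_d) : exists x, f (MinElt i) = lower H x.
  have [j ij] := other i.
  by have [x [y [-> _]]] := pair i j ij; exists x.
have /boolp.choice[b bP] (i : 'I_d) : exists y, f (MaxElt i) = upper H y.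
  have [j ij] := other i.
  by rewrite eq_sym in ij; have [x [y [_ ->]]] := pair j i ij; exists y.
have Hab i j : H (a i) (b j) = (i == j).
  by apply/negb_inj; rewrite -lower_le_upper -aP -bP fP.
have inja : injective a by move=> i j e; apply/eqP; rewrite -Hab e Hab.
have injb : injective b by move=> i j e; apply/eqP; rewrite -Hab -e Hab.
have := @exists_subset_card _ [set: 'I_d] C; rewrite cardsT card_ord => /(_ Cd)[I _ kI].
have := denseH (a @: I) (b @: I); rewrite !card_imset // => /(_ kI kI).
apply/negP; rewrite -ltnNge; apply: leq_ltn_trans Ct.
rewrite -kI -(card_imset I (f := fun i => (a i, b i))); last by move=> i j [/inja].
apply: subset_leq_card; apply/subsetP => -[x y]; rewrite !inE /=.
move=> /andP[/andP[/imsetP[i Ii ->] /imsetP[j Ij ->]]]; rewrite Hab => /eqP <-.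
by apply/imsetP; exists i.
Qed.

(** * Choice of the parameters *)

(** Instance [r = 7], [M = n * l], [t = 14 * M] of the construction.  As [n] is
    about [m ^ 3] up to logarithms, [K_(k,k)] is absent for [k] above 6; the choice
    [k = 8] leaves a power of [m] that absorbs the logarithms. *)
Lemma hard_poset (n m C l : nat) :
  2 < n -> 0 < l -> 0 < m -> 7 <= C -> C <= n -> 2 * n <= 2 ^ l ->
  16 * C <= l * m ^ 2 -> 34 * m * n * l <= C ^ 2 -> 8 * n ^ 2 <= m ^ 8 ->
  exists H : rel 'I_n,
    n < poset_dim (cobip H) + C /\ se_number (cobip H) < C.
Proof.
case: m => // m n2 l0 _ C7 Cn nl Cm mC nm.
have n_nl : n <= n * l by rewrite leq_pmulr.
have nl3 : 3 <= n * l by apply: leq_trans n_nl.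
have [|||| H [h1 h2 h3 h4]] := @random_graph 'I_n m C (n * l) (2 * 7 * (n * l)) 8.
- have sum_le : 2 * n + 2 * 7 * (n * l) + 3 <= 17 * (n * l) by lia.
  rewrite card_ord; apply: leq_trans mC.
  by apply: leq_trans (leq_mul (leqnn _) sum_le) _; clear; lia.
- by rewrite card_ord; have := leq_mul Cm (leqnn n); lia.
- rewrite card_ord (@leq_trans (2 ^ (n * l) * 2 ^ (n * l))) //.
    apply: leq_mul; first by rewrite (@leq_exp2l 2 3).
    by rewrite (mulnC n l) expnM; apply: leq_pow2r.
  by rewrite -expnMn.
- rewrite card_ord (expnM n 2 8) (expnM m.+1 8 8).
  apply: leq_trans (leq_pow2r 8 nm); rewrite expnMn leq_mul2r.
  by rewrite -[X in X <= _]expn1 leq_exp2l // orbT.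
exists H; split.
  have := @cobip_dim _ H C (n * l) 7 h1 h2 h3 h4.
  by rewrite card_ord; apply => //; lia.
by apply: (cobip_se h1); clear - n_nl Cn C7 n2; lia.
Qed.

(** With [q = u %/ 4], the power [2 ^ u] is at least [(2 ^ q) ^ 4 >= (q + 1) ^ 4],
    one degree more than the left-hand side. *)
Lemma cube_leq_exp2 (K : nat) :
  exists u0, forall u, u0 <= u -> K * (2 * u + 1) ^ 3 <= 2 ^ u.
Proof.
exists (4 * (8 ^ 3 * K)) => u; set A := 8 ^ 3 * K => uA.
have := divn_eq u 4; have := ltn_pmod u (isT : 0 < 4).
set q := u %/ 4; set s := u %% 4 => s4 uE.
apply: (@leq_trans (q.+1 ^ 4)); last first.
  apply: (@leq_trans (2 ^ (q * 4))); last by rewrite leq_exp2l // uE leq_addr.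
  by rewrite expnM; apply: leq_pow2r; apply: ltn_expl.
apply: (@leq_trans (A * q.+1 ^ 3)); last first.
  by rewrite (expnS _ 3) leq_mul2r; apply/orP; right; lia.
rewrite /A (mulnC _ K) -mulnA -expnMn leq_mul2l.
by apply/orP; right; apply: leq_pow2r; lia.
Qed.

(** For given [C] and [l], take the least [m] with [16 C <= l m^2] and then the
    largest [n] with [34 m n l <= C^2].  So [m] is about [(C / l)^(1/2)] and [n]
    about [C^(3/2) / l^(1/2)], up to constants. *)
Lemma hard_parameters (C l : nat) :
  7 <= C -> 0 < l -> l ^ 3 < 16 * C -> 68 ^ 2 * 64 * l <= C -> 2 * C ^ 2 <= 2 ^ l ->
  exists n (H : rel 'I_n), [/\ 2 * C <= n, n < poset_dim (cobip H) + C,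
    se_number (cobip H) < C & C ^ 3 <= 68 ^ 2 * 64 * l * n ^ 2].
Proof.
move=> C7 l0 lC lC' C2l.
have lC1 : l <= C by lia.
have exm : exists m, 16 * C <= l * m ^ 2 by exists (16 * C); rewrite -mulnn; nia.
case: (ex_minnP exm) => m Cm minm {exm}.
have m2 : 1 < m by move: Cm; case: (m) => [|[|m']] //; lia.
have {minm} mC : l * m ^ 2 <= 64 * C.
  have mlt : l * m.-1 ^ 2 < 16 * C by rewrite ltnNge; apply/negP => /minm; lia.
  apply: (@leq_trans (l * (2 * m.-1) ^ 2)); last by rewrite expnMn; lia.
  by rewrite leq_mul2l; apply/orP; right; apply: leq_pow2r; lia.
have lm : l <= m.
  rewrite leqNgt; apply/negP => ml.
  have : l * m ^ 2 <= l ^ 3.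
    by rewrite (expnS l 2) leq_mul2l; apply/orP; right; apply/leq_pow2r/ltnW.
  by lia.
pose n := C ^ 2 %/ (34 * m * l).
have ml0 : 0 < 34 * m * l by rewrite !muln_gt0 l0; lia.
have nle : n * (34 * m * l) <= C ^ 2 by apply: leq_divM.
have nlt : C ^ 2 < n.+1 * (34 * m * l) by rewrite -ltn_divLR.
have Cn : 2 * C <= n.
  rewrite leqNgt; apply/negP => nC.
  have h : C < 68 * m * l.
    have C0 : 0 < C by lia.
    rewrite -(ltn_pmul2l C0) mulnn; apply: leq_trans nlt _.
    by have := leq_mul nC (leqnn (34 * m * l)); lia.
  have h2 : C ^ 2 < (68 * m * l) ^ 2 by rewrite ltn_exp2r.
  have h3 := leq_mul (leqnn (68 ^ 2 * l)) mC.
  have h4 := leq_mul lC' (leqnn C).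
  by clear - h2 h3 h4; lia.
have nC2 : n <= C ^ 2 by apply: leq_div.
have nm : 8 * n <= m ^ 4.
  have h : (n * (256 * 34)) * (m * l) <= (l * m ^ 3) * (m * l).
    have : (16 * C) ^ 2 <= (l * m ^ 2) ^ 2 by rewrite leq_exp2r.
    by lia.
  rewrite leq_pmul2r in h; last by lia.
  have : l * m ^ 3 <= m ^ 4 by rewrite (expnS m 3) leq_mul2r lm orbT.
  by lia.
have [||||||||| H [Hdim Hse]] := @hard_poset n m C l.
- by lia.
- by [].
- by lia.
- by [].
- by lia.
- by lia.
- by [].
- by apply: leq_trans nle; lia.
- have nm' : n <= m ^ 4 by lia.
  by have := leq_mul nm nm'; lia.
exists n, H; split => //.
have h : C ^ 2 <= 68 * m * l * n.
  have n2 : n.+1 <= 2 * n by lia.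
  by have := leq_mul n2 (leqnn (34 * m * l)); lia.
have h2 : (C ^ 2) ^ 2 <= (68 * m * l * n) ^ 2 by rewrite leq_exp2r.
have h3 := leq_mul (leqnn (68 ^ 2 * l * n ^ 2)) mC.
have C0 : 0 < C by lia.
rewrite -(leq_pmul2r C0); clearbody n; clear - h2 h3; lia.
Qed.

(** Taking [l = 2 * up_log 2 C + 1] ensures [2 * n <= 2 * C ^ 2 <= 2 ^ l]. *)
Lemma hard_posets : exists C0, forall C, C0 <= C ->
  exists n (H : rel 'I_n), [/\ 2 * C <= n, n < poset_dim (cobip H) + C,
    se_number (cobip H) < C &
    C ^ 3 <= 68 ^ 2 * 64 * (2 * up_log 2 C + 1) * n ^ 2].
Proof.
have [u0 hu0] := cube_leq_exp2 (2 * (68 ^ 2 * 64)).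
exists (2 ^ u0 + 7) => C CC0; set u := up_log 2 C.
have C7 : 7 <= C by lia.
have /andP[lo hi] : 2 ^ u.-1 < C <= 2 ^ u by apply: up_log_bounds; lia.
have u0u : u0 <= u by rewrite -(@leq_exp2l 2) //; lia.
have := hu0 _ u0u; set l := 2 * u + 1 => hu.
have u_gt0 : 0 < u by case: (u) hi => // hi; lia.
have uE : 2 ^ u = 2 * 2 ^ u.-1 by rewrite -expnS prednK.
have lC : 68 ^ 2 * 64 * l ^ 3 < C by move: hu lo uE; clearbody l; lia.
have l1 : l <= l ^ 3 by rewrite -[X in X <= _]expn1 leq_pexp2l // /l addn1.
apply: hard_parameters => //.
- by rewrite /l addn1.
- by clearbody l; lia.
- by clearbody l; lia.
rewrite /l expnD mulnC expnM expnAC leq_mul //.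
by apply: leq_pow2r.
Qed.

(** * Asymptotics *)

Local Open Scope classical_set_scope.
Local Open Scope ring_scope.

Lemma ln2_ge_half (R : realType) : 2^-1 <= ln 2 :> R.
Proof.
rewrite -[leLHS]expRK ler_ln ?posrE ?expR_gt0 // -[leLHS]invrK -expRN.
rewrite -[leRHS]invrK lef_pV2 ?posrE ?expR_gt0 //.
by apply: le_trans (expR_ge1Dx _); lra.
Qed.

Lemma ln_ge1 (R : realType) (c : nat) : (3 < c)%N -> 1 <= ln c%:R :> R.
Proof.
move=> c4; apply: (@le_trans _ _ (ln (2 ^+ 2))).
  by rewrite lnXn // mulr2n; have := ln2_ge_half R; lra.
by rewrite ler_ln ?posrE ?exprn_gt0 ?ltr0n -?natrX ?ler_nat //; lia.
Qed.

Lemma up_log2_le_ln (R : realType) (c : nat) : (3 < c)%N ->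
  (2 * up_log 2 c.+1 + 1)%:R <= 11 * ln c%:R :> R.
Proof.
move=> c4; set u := up_log 2 c.+1.
have lo : (2 ^ u.-1 < c.+1)%N by apply: up_log_gtn => //; lia.
have c0 : 0 < c%:R :> R by rewrite ltr0n; lia.
have ln1 := ln_ge1 R c4; have ln2 := ln2_ge_half R.
have hu : u.-1%:R * ln 2 <= ln c%:R :> R.
  rewrite mulr_natl -lnXn // ler_ln ?posrE ?exprn_gt0 //.
  by rewrite -natrX ler_nat -ltnS.
have u_le : u%:R <= u.-1%:R + 1 :> R by rewrite natr1 ler_nat; lia.
have v0 : 0 <= u.-1%:R :> R by [].
have hv : u.-1%:R * 2^-1 <= ln c%:R :> R by apply: le_trans hu; rewrite ler_wpM2l.
rewrite natrD natrM; lra.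
Qed.

Theorem mainTheorem4 (R : realType) (sa : nat -> nat)
    (sa_gt0 : forall c : nat, (0 < c)%N -> (0 < sa c)%N)
    (saP : forall c : nat, (0 < c)%N -> forall n : nat, (sa c < n)%N ->
       forall (disp : Order.disp_t) (P : finPOrderType disp),
         #|P| = (2 * n + 1)%N -> (n - c <= poset_dim P)%N -> (n - sa c <= se_number P)%N) :
  (fun c : nat => (sa c)%:R : R) \is
    'Omega_\oo (fun c : nat => c%:R `^ (3 / 2) / (ln c%:R) `^ (3 / 4) : R).
Proof.
have [C0 hard] := hard_posets.
have sa_large c : (C0 <= c -> 3 < c ->
    c ^ 3 <= 4 * (68 ^ 2 * 64) * (2 * up_log 2 c.+1 + 1) * sa c ^ 2)%N.
  move=> C0c c3; have [|n [H [Cn Hdim Hse Cn3]]] := hard c.+1; first by lia.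
  have sa_n : (n <= 2 * sa c)%N.
    suff : (n - c <= sa c)%N by lia.
    have [nsa|nsa] := leqP n (sa c); first by lia.
    have c0 : (0 < c)%N by lia.
    have := saP c c0 n nsa _ (cobip H).
    rewrite card_cobip card_ord => /(_ erefl); lia.
  have nsa2 : (n ^ 2 <= (2 * sa c) ^ 2)%N by rewrite leq_exp2r.
  have cC : (c ^ 3 <= c.+1 ^ 3)%N by rewrite leq_exp2r.
  apply: leq_trans (leq_trans cC Cn3) _.
  apply: leq_trans (leq_mul (leqnn _) nsa2) _.
  by rewrite expnMn; move: (68 ^ 2 * 64)%N (2 * _ + 1)%N (sa c ^ 2)%N => K l s; lia.
(* The constant is chosen with [(7 * 68 * 8) ^ 2 >= 11 * 4 * 68 ^ 2 * 64]. *)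
rewrite qualifE /=; apply/asboolP; exists (7 * 68 * 8)^-1.
  by rewrite invr_gt0 !mulr_gt0 ?ltr0n.
near=> c.
have c3 : (3 < c)%N by near: c; exists 4%N.
have Cc : (C0 <= c)%N by near: c; exists C0.
have c0 : 0 < c%:R :> R by rewrite ltr0n; lia.
have lnc1 := ln_ge1 R c3.
set l := ln c%:R in lnc1 *.
have l0 : 0 < l by lra.
have a2 : (c%:R `^ (3 / 2)) ^+ 2 = c%:R ^+ 3 :> R.
  rewrite -powR_mulrn ?powR_ge0 // -powRrM divfK // -powR_mulrn //.
have b2 : l <= (l `^ (3 / 4)) ^+ 2.
  rewrite -powR_mulrn ?powR_ge0 // -powRrM -[leLHS]powRr1; last by lra.
  rewrite ler_powR //; lra.
set a := c%:R `^ (3 / 2) in a2 *; set b := l `^ (3 / 4) in b2 *.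
have b0 : 0 < b by rewrite powR_gt0.
have a0 : 0 <= a by rewrite powR_ge0.
rewrite !ger0_norm ?divr_ge0 ?(ltW b0) //.
rewrite mulrA ler_pdivrMr // -ler_sqr ?nnegrE ?mulr_ge0 ?(ltW b0) ?invr_ge0 ?ler0n //.
rewrite !exprMn a2.
have := @up_log2_le_ln R c c3; rewrite -/l.
set u := (_ + 1)%:R; set s := (sa c)%:R => h1.
have h2 : c%:R ^+ 3 <= 4 * (68 ^+ 2 * 64) * u * s ^+ 2.
  by rewrite -!natrX -!natrM ler_nat; apply: sa_large.
have h3 : u * s ^+ 2 <= 11 * b ^+ 2 * s ^+ 2.
  by rewrite ler_wpM2r ?sqr_ge0 //; lra.
rewrite exprVn ler_pdivrMl ?exprn_gt0 //.
have h4 : 0 <= b ^+ 2 * s ^+ 2 by rewrite mulr_ge0 ?sqr_ge0.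
move: h2; rewrite -!mulrA => h2; lra.
Unshelve. all: by end_near. Qed.
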